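(* Let $G$ be a connected cubic graph on $n$ vertices with girth $\ell$. For every $\tau\in\{\ell-1,\ell,\ldots,2\ell-1\}$, $$\gamma(G) \ge 1+\frac n4-\frac12\left[ \frac{3n}{\tau+1} + \sum_{k=\ell}^{\tau} \left(1-\frac{k}{\tau+1}\right)c_k(G) \right],$$ with the convention that the sum is empty for $\tau=\ell-1$. Since $\gamma(G)$ is an integer, the bound also holds with the right side rounded up.
   Context: All graphs are finite and simple; cubic means $3$-regular; the girth $\ell$ is the length of a shortest cycle; $c_k(G)$ is the number of cycles of length $k$ in $G$ (unoriented, as subgraphs). A dart of $G$ is an ordered pair $(u,v)$ with $uv\in E(G)$. A rotation system $\rho$ of $G$ assigns to each vertex $v$ a cyclic ordering of its neighbours; $\sigma_v(u)$ denotes the neighbour of $v$ following $u$. The face permutation on darts is $\phi_\rho(u,v)=(v,\sigma_v(u))$; its cycles are the faces of $\rho$, and $F(\rho)$ is their number. For a connected cubic graph on $n$ vertices the genus of $\rho$ is given by Euler's formula, $g(\rho)=1+\frac n4-\frac12F(\rho)$, and $\gamma(G)=\min_\rho g(\rho)$ is the minimum orientable genus. *)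

(* Defs.v *)
From mathcomp Require Import all_boot all_order all_algebra all_fingroup.
Set Implicit Arguments.
Unset Strict Implicit.
Unset Printing Implicit Defensive.
Import Order.TTheory GRing.Theory Num.Theory.
Local Open Scope ring_scope.

Record sgraph := SGraph {
  vertex :> finType;
  edge : rel vertex;
  edge_sym : symmetric edge;
  edge_irrefl : irreflexive edge }.

Definition neighbours (G : sgraph) (v : G) : {set G} := [set u | edge v u].

Definition cubic (G : sgraph) : Prop := forall v : G, #|neighbours v| = 3.

Definition connected (G : sgraph) : Prop :=
  forall u v : G, connect (@edge G) u v.

(* A cycle of G, as an unoriented subgraph, is identified with its edge set;
   an edge is the two-element set of its endpoints.  The condition 2 < k
   excludes an edge traversed back and forth. *)
Definition cycle_edges (G : sgraph) (s : seq G) : {set {set G}} :=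
  [set [set x; next s x] | x in s].

Definition is_cycle (G : sgraph) (k : nat) (C : {set {set G}}) : bool :=
  (2 < k)%N &&
  [exists s : k.-tuple G, ucycleb (@edge G) s && (C == cycle_edges s)].

Definition num_cycles (G : sgraph) (k : nat) : nat :=
  #|[set C : {set {set G}} | is_cycle k C]|.

Definition has_girth (G : sgraph) (l : nat) : Prop :=
  (exists C : {set {set G}}, is_cycle l C) /\
  (forall (k : nat) (C : {set {set G}}), is_cycle k C -> (l <= k)%N).

(* A cyclic ordering of the neighbours of v is given by its successor
   function, a permutation having the neighbours of v as a single orbit.  It is
   required to fix all other vertices, so that each cyclic ordering is
   represented exactly once. *)
Definition cyclic_order (G : sgraph) (v : G) (s : {perm G}) : bool :=
  perm_on (neighbours v) s &&
  [forall u in neighbours v, porbit s u == neighbours v].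

Definition is_rotation (G : sgraph) (r : {ffun G -> {perm G}}) : bool :=
  [forall v, cyclic_order v (r v)].

Definition rotation (G : sgraph) : Type :=
  {r : {ffun G -> {perm G}} | is_rotation r}.

Definition rot_at (G : sgraph) (rho : rotation G) (v : G) : {perm G} := val rho v.

Lemma rot_atP (G : sgraph) (rho : rotation G) (v : G) : cyclic_order v (rot_at rho v).
Proof. exact: (forallP (valP rho) v). Qed.

Definition dart (G : sgraph) : Type := {d : G * G | edge d.1 d.2}.

Lemma edge_rot_at (G : sgraph) (rho : rotation G) (u v : G) :
  edge u v -> edge v (rot_at rho v u).
Proof.
move=> euv; have /andP[on_v _] := rot_atP rho v.
by have := perm_closed u on_v; rewrite !inE => ->; rewrite edge_sym.
Qed.

Definition face_fun (G : sgraph) (rho : rotation G) (d : dart G) : dart G :=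
  exist (fun d : G * G => edge d.1 d.2)
    ((val d).2, rot_at rho (val d).2 (val d).1) (edge_rot_at rho (valP d)).

Lemma face_fun_inj (G : sgraph) (rho : rotation G) : injective (face_fun rho).
Proof.
move=> [[u v] euv] [[u' v'] euv'] /(congr1 val) /= [vE].
by rewrite -{}vE in euv' * => /perm_inj uE; apply: val_inj; rewrite /= uE.
Qed.

Definition face_perm (G : sgraph) (rho : rotation G) : {perm dart G} :=
  perm (@face_fun_inj G rho).

Definition num_faces (G : sgraph) (rho : rotation G) : nat :=
  #|porbits (face_perm rho)|.

(* Euler's formula for connected cubic graphs, with 3n/2 edges on n vertices. *)
Definition cubic_genus (G : sgraph) (rho : rotation G) : rat :=
  1 + #|G|%:R / 4%:R - 1 / 2%:R * (num_faces rho)%:R.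

(* Rotation systems exist, so that the minimum below is attained. *)
Lemma next_inj (T : finType) (s : seq T) : uniq s -> injective (next s).
Proof. by move=> Us; apply: can_inj (prev_next Us). Qed.

Definition default_ffun (G : sgraph) : {ffun G -> {perm G}} :=
  [ffun v => perm (next_inj (enum_uniq (neighbours v)))].

Lemma default_ffunP (G : sgraph) : is_rotation (default_ffun G).
Proof.
apply/forallP => v; rewrite ffunE; set Us := enum_uniq _.
apply/andP; split.
  apply/subsetP => u; rewrite !inE permE; apply: contraR => Nuv.
  by rewrite next_nth mem_enum inE (negbTE Nuv).
apply/forall_inP => u Nu; apply/eqP/setP => w.
have uN : u \in enum (neighbours v) by rewrite mem_enum.
rewrite -[RHS]mem_enum -(fconnect_cycle (cycle_next Us) uN).
have itE i : (perm (next_inj Us) ^+ i)%g u =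
    iter i (next (enum (neighbours v))) u.
  by rewrite permX; apply: eq_iter => x; rewrite permE.
apply/porbitP/idP => [[i ->]|/iter_findex <-].
  by rewrite itE fconnect_iter.
by exists (findex (next (enum (neighbours v))) u w); rewrite itE.
Qed.

Definition default_rotation (G : sgraph) : rotation G :=
  exist _ (default_ffun G) (default_ffunP G).

Definition cubic_min_genus (G : sgraph) : rat :=
  cubic_genus [arg min_(rho < default_rotation G) cubic_genus rho]%O.

(* Main.v *)
Require Import Defs.
From mathcomp Require Import all_boot all_order all_algebra all_fingroup.
From mathcomp Require Import zify ring.
Set Implicit Arguments.
Unset Strict Implicit.
Unset Printing Implicit Defensive.
Import Order.TTheory GRing.Theory Num.Theory.
Local Open Scope ring_scope.

(** The orbits of the face permutation partition the 3n darts, so averaging the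
    weight 1 - k/(tau+1) of a face of length k gives
      F - 3n/(tau+1) = sum over the faces X of (1 - |X|/(tau+1)).
    Faces longer than tau contribute at most 0.  A face of length k <= tau is
    charged to a cycle of length k, so everything rests on two facts about faces
    of length k < 2l.

    Such a face is a cycle ([short_face_is_cycle]).  In a cubic graph a rotation
    acts on neighbours as a 3-cycle, so face walks never backtrack; a closed walk
    that does not backtrack contains a cycle, hence has length at least the girth
    l ([closed_nonbacktracking_girth]).  A face walk that repeats a vertex splits
    into two such closed walks, which costs length 2l.  The same argument shows
    that no face is shorter than l, so the sum may start at l.

    Distinct short faces are distinct cycles ([short_face_edges_inj]).  Two faces
    that share a dart are equal, so the only danger is a cycle traced in both
    directions; at a vertex v this would make the rotation exchange the two
    neighbours of v on the cycle, impossible for a 3-cycle.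

    Integrality is a parity argument ([odd_num_faces]).  Reversing darts and then
    applying the face permutation turns each dart about its tail; the resulting
    permutation has order 3 and is even.  So the face permutation has the sign of
    the reversal, which has one orbit per edge: the numbers of faces and of edges
    have the same parity, and so the genus is an integer. *)

(** * Orbits and parity of permutations *)

Section PermOrbits.
Local Open Scope nat_scope.

Lemma partition_porbits (T : finType) (s : {perm T}) :
  partition (porbits s) [set: T].
Proof.
have sT : [acts <[s]>%g, on [set: T] | 'P]%g by apply/actsP=> a _ x; rewrite !inE.
have := orbit_partition sT.
suff -> : (orbit 'P <[s]> @: [set: T])%g = porbits s by [].
by rewrite /porbits porbit.unlock; apply/setP => A;
  apply/imsetP/imsetP => -[x _ ->]; exists x; rewrite ?inE.
Qed.

Lemma sum_card_porbits (T : finType) (s : {perm T}) :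
  \sum_(X in porbits s) #|X| = #|T|.
Proof. by rewrite -(card_partition (partition_porbits s)) cardsT. Qed.

Lemma porbits_eq (T : finType) (s : {perm T}) (X Y : {set T}) x :
  X \in porbits s -> Y \in porbits s -> x \in X -> x \in Y -> X = Y.
Proof.
case/imsetP=> y _ -> /imsetP[z _ ->]; rewrite -!eq_porbit_mem.
by move=> /eqP <- /eqP <-.
Qed.

Lemma porbit_closed (T : finType) (s : {perm T}) (X : {set T}) x :
  X \in porbits s -> (s x \in X) = (x \in X).
Proof.
case/imsetP=> y _ ->; rewrite -!eq_porbit_mem.
have -> // : porbit s (s x) = porbit s x.
by apply/eqP; rewrite eq_porbit_mem -{1}[s]expg1 mem_porbit.
Qed.

(** All orbits have two elements. *)
Lemma fixfree_involution_porbits (T : finType) (s : {perm T}) :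
  (forall x, s (s x) = x) -> (forall x, s x != x) -> #|T| = #|porbits s| * 2.
Proof.
move=> sK s_free; rewrite -cardsT.
apply: card_uniform_partition (partition_porbits s) => _ /imsetP[x _ ->].
have -> : porbit s x = [set x; s x]; last by rewrite cards2 eq_sym s_free.
apply/setP => y; rewrite !inE; apply/porbitP/orP => [[i ->]|[]/eqP->].
- elim: i => [|i IH]; first by left; rewrite expg0 perm1.
  by rewrite expgSr permM; case: IH => /eqP->; [right | left; rewrite sK].
- by exists 0; rewrite expg0 perm1.
by exists 1; rewrite expg1.
Qed.

(** The sign is a homomorphism to a group of order 2, and s ^ 3 = 1. *)
Lemma odd_perm_order3 (T : finType) (s : {perm T}) :
  (forall x, s (s (s x)) = x) -> odd_perm s = false.
Proof.
move=> s3; have : odd_perm (s * (s * s))%g = false.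
  have -> : (s * (s * s) = 1)%g by apply/permP => x; rewrite !permM perm1 s3.
  exact: odd_perm1.
by rewrite !odd_permM; case: (odd_perm s).
Qed.

End PermOrbits.

(** * Walks without backtracking *)

Section Walks.
Local Open Scope nat_scope.

Lemma set2_eqP (T : finType) (a b c d : T) :
  [set a; b] = [set c; d] -> a = c /\ b = d \/ a = d /\ b = c.
Proof.
move=> E.
have aE : a \in [set c; d] by rewrite -E set21.
have bE : b \in [set c; d] by rewrite -E set22.
have cE : c \in [set a; b] by rewrite E set21.
have dE : d \in [set a; b] by rewrite E set22.
case/set2P: aE => ?; case/set2P: bE => ?; subst; auto.
  by move: dE; rewrite !inE orbb => /eqP->; left.
by move: cE; rewrite !inE orbb => /eqP->; left.
Qed.

Lemma mkseq_cycle (T : eqType) (e : rel T) (a : nat -> T) (m : nat) :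
  (forall i, e (a i) (a i.+1)) -> a m = a 0 -> path.cycle e (mkseq a m).
Proof.
case: m => [//|m] ea am0.
have aS : mkseq a m.+1 = a 0 :: mkseq (a \o S) m.
  by rewrite /mkseq /= (iotaDl 1) -map_comp.
have aR : rcons (mkseq (a \o S) m) (a 0) = mkseq (a \o S) m.+1.
  by rewrite mkseqS /= am0.
rewrite aS /= aR; apply/(pathP (a 0)) => i; rewrite size_mkseq => lt_im.
rewrite nth_mkseq //=; case: i lt_im => [_|i lt_im] //=.
by rewrite -/(mkseq _ _) nth_mkseq //= ltnW.
Qed.

Lemma next_mkseq (T : eqType) (a : nat -> T) (m i : nat) :
  uniq (mkseq a m) -> a m = a 0 -> i < m -> next (mkseq a m) (a i) = a i.+1.
Proof.
case: m => [//|m] Ua am0 lt_im.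
have ai : nth (a 0) (mkseq a m.+1) i = a i by rewrite nth_mkseq.
rewrite next_nth -ai mem_nth ?size_mkseq // index_uniq ?size_mkseq //.
have -> : mkseq a m.+1 = a 0 :: mkseq (a \o S) m.
  by rewrite /mkseq /= (iotaDl 1) -map_comp.
(* At the last index, the default value a 0 = a m.+1 of nth is the successor. *)
move: lt_im; rewrite ltnS leq_eqVlt => /predU1P[->|lt_im].
  by rewrite nth_default ?size_mkseq.
by rewrite nth_mkseq.
Qed.

Lemma mkseq_uniq_or_repeat (T : eqType) (a : nat -> T) (m : nat) :
  uniq (mkseq a m) \/ exists p q, [/\ p < q, q < m & a p = a q].
Proof.
case: (boolP (uniq (mkseq a m))) => [|/(uniqPn (a 0))]; first by left.
case=> p [q] [lt_pq]; rewrite size_mkseq => lt_qm.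
rewrite !nth_mkseq //; last exact: ltn_trans lt_qm.
by move=> apq; right; exists p, q.
Qed.

(** An infinite sequence lets closed walks be restarted anywhere along a face
    without index arithmetic modulo its length. *)
Definition nonbacktracking (G : sgraph) (a : nat -> G) : Prop :=
  forall i, edge (a i) (a i.+1) /\ a i.+2 != a i.

(** Irreflexivity of the edge relation excludes length 1, and the absence of
    backtracking excludes length 2. *)
Lemma nonbacktracking_cycle (G : sgraph) (a : nat -> G) (m : nat) :
    nonbacktracking a -> 0 < m -> a m = a 0 -> uniq (mkseq a m) ->
  is_cycle m [set [set a (val i); a (val i).+1] | i : 'I_m].
Proof.
move=> a_nb m_gt0 am0 Ua; apply/andP; split.
  case: m m_gt0 am0 {Ua} => [|[|[|m]]] // _ am0.
    by have [] := a_nb 0; rewrite am0 edge_irrefl.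
  by have [] := a_nb 0; rewrite am0 eqxx.
have sz : size (mkseq a m) == m by rewrite size_mkseq.
apply/existsP; exists (Tuple sz); rewrite /ucycleb /= Ua andbT.
apply/andP; split; first by apply: mkseq_cycle am0 => i; case: (a_nb i).
apply/eqP/setP => e; apply/imsetP/imsetP => [[i _ ->]|[x /mapP[i]]].
  exists (a i); last by rewrite next_mkseq.
  by apply/mapP; exists (val i); rewrite ?mem_iota /=.
rewrite mem_iota /= => lt_im -> ->.
by exists (Ordinal lt_im); rewrite //= next_mkseq.
Qed.

(** A shortest closed piece of the walk repeats no vertex, so it is a cycle.  The
    walk may backtrack at its base point a 0 = a m, which is why the argument
    cuts out pieces of the walk instead of rotating it. *)
Lemma closed_nonbacktracking_girth (G : sgraph) (l : nat) (a : nat -> G) m :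
  has_girth G l -> nonbacktracking a -> 0 < m -> a m = a 0 -> l <= m.
Proof.
case=> _ Gl; elim/ltn_ind: m a => m IH a a_nb m_gt0 am0.
have [Ua|[p [q [lt_pq lt_qm apq]]]] := mkseq_uniq_or_repeat a m.
  exact: Gl (nonbacktracking_cycle a_nb m_gt0 am0 Ua).
suff : l <= q - p by lia.
apply: (IH (q - p) _ (fun i => a (p + i))); try lia.
  by move=> i; rewrite !addnS; apply: a_nb.
by rewrite subnKC ?addn0 // ltnW.
Qed.

End Walks.

(** * Short faces are cycles *)

Section Faces.
Local Open Scope nat_scope.
Variables (G : sgraph) (rho : rotation G).
Hypothesis Gcubic : cubic G.

(** The only place where the degree 3 matters for the shape of faces: it forbids
    backtracking (first clause) and the tracing of one cycle in both directions
    (second clause). *)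
Lemma rot_at_cycle3 (v u : G) : edge v u ->
  let s := rot_at rho v in [/\ s u != u, s (s u) != u & s (s (s u)) = u].
Proof.
move=> evu s; have /andP[_ /forall_inP/(_ u)] := rot_atP rho v.
rewrite inE => /(_ evu)/eqP s_orb.
have c3 : #|porbit s u| = 3 by rewrite s_orb Gcubic.
have := uniq_traject_porbit s u; have := iter_porbit s u.
rewrite {}c3 /= => ->; rewrite !inE negb_or andbT => /andP[/andP[su ssu] _].
by split; rewrite // eq_sym.
Qed.

Let f := face_perm rho.

Lemma face_permE (d : dart G) :
  val (f d) = ((val d).2, rot_at rho (val d).2 (val d).1).
Proof. by rewrite permE. Qed.

Definition face_walk (d : dart G) (i : nat) : G := (val (iter i f d)).1.

Lemma face_walkS d i : face_walk d i.+1 = (val (iter i f d)).2.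
Proof. by rewrite /face_walk iterS face_permE. Qed.

Lemma face_walk_nonbacktracking d : nonbacktracking (face_walk d).
Proof.
move=> i; rewrite !face_walkS iterS face_permE /= /face_walk.
have e := valP (iter i f d); split=> //.
by case: (rot_at_cycle3 (u := (val (iter i f d)).1)
  (v := (val (iter i f d)).2)) => //; rewrite edge_sym.
Qed.

Definition face_edges (X : {set dart G}) : {set {set G}} :=
  [set [set (val d).1; (val d).2] | d in X].

Lemma face_walk_period d i :
  face_walk d (i + #|porbit f d|) = face_walk d i.
Proof. by rewrite /face_walk iterD iter_porbit. Qed.

Lemma card_porbit_gt0 d : 0 < #|porbit f d|.
Proof. by rewrite lt0n card_porbit_neq0. Qed.

Lemma face_walk0_period d : face_walk d #|porbit f d| = face_walk d 0.
Proof. exact: face_walk_period d 0. Qed.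

Lemma face_length_girth l d : has_girth G l -> l <= #|porbit f d|.
Proof.
move=> Gl; apply: closed_nonbacktracking_girth Gl _ _ (face_walk0_period d).
  exact: face_walk_nonbacktracking.
exact: card_porbit_gt0.
Qed.

(** A repeated vertex cuts the closed face walk into two closed walks, each of
    length at least l. *)
Lemma short_face_walk_uniq l d : has_girth G l -> #|porbit f d| < 2 * l ->
  uniq (mkseq (face_walk d) #|porbit f d|).
Proof.
move=> Gl short; set k := #|porbit f d| in short *.
have [//|[p [q [lt_pq lt_qk apq]]]] := mkseq_uniq_or_repeat (face_walk d) k.
have shift r : nonbacktracking (fun i => face_walk d (r + i)).
  by move=> i; rewrite !addnS; apply: face_walk_nonbacktracking.
have : l <= q - p.
  apply: (closed_nonbacktracking_girth Gl (shift p)); first by lia.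
  by rewrite subnKC ?addn0 // ltnW.
(* The complementary piece runs from q through the base point up to p + k. *)
have : l <= p + k - q.
  apply: (closed_nonbacktracking_girth Gl (shift q)); first by lia.
  by rewrite subnKC ?face_walk_period ?addn0 //; lia.
lia.
Qed.

Lemma mem_porbit_iter d e :
  e \in porbit f d -> exists2 i, i < #|porbit f d| & e = iter i f d.
Proof. by rewrite porbit_traject => /trajectP. Qed.

Lemma short_face_is_cycle l d : has_girth G l -> #|porbit f d| < 2 * l ->
  is_cycle #|porbit f d| (face_edges (porbit f d)).
Proof.
move=> Gl short.
have := nonbacktracking_cycle (face_walk_nonbacktracking d) (card_porbit_gt0 d)
  (face_walk0_period d) (short_face_walk_uniq Gl short).
set C := (C in is_cycle _ C); suff -> : face_edges (porbit f d) = C by [].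
apply/setP => e; apply/imsetP/imsetP => [[d']|[i _ ->]].
  case/mem_porbit_iter=> i lt_i -> ->.
  by exists (Ordinal lt_i); rewrite //= face_walkS.
exists (iter i f d); last by rewrite face_walkS.
rewrite porbit_traject; apply/trajectP; exists (val i); [exact: ltn_ord|by []].
Qed.

Lemma short_face_tail_inj l d : has_girth G l -> #|porbit f d| < 2 * l ->
  {in porbit f d &, forall d1 d2, (val d1).1 = (val d2).1 -> d1 = d2}.
Proof.
move=> Gl short _ _ /mem_porbit_iter[i lt_i ->] /mem_porbit_iter[j lt_j ->] eq_ij.
by rewrite ((mkseq_uniqP _ _ (short_face_walk_uniq Gl short)) i j _ _ eq_ij).
Qed.

(** If d = (u, v) lies on X and its edge is traced by Y as (v, u), let e' = (x, v)
    be the dart of Y before (v, u).  Its edge is also traced by X, as (v, x); since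
    X leaves v only once, x is the successor of u at v.  But u is the successor of
    x at v, and the rotation at v would have a 2-cycle. *)
Lemma short_face_edges_inj l X Y : has_girth G l ->
    X \in porbits f -> Y \in porbits f -> #|X| < 2 * l ->
  face_edges X = face_edges Y -> X = Y.
Proof.
move=> Gl fX fY short eqXY.
have X_inj : {in X &, forall d1 d2, (val d1).1 = (val d2).1 -> d1 = d2}.
  case/imsetP: fX short => d _ ->; exact: short_face_tail_inj.
have [d Xd] : exists d, d \in X.
  by case/imsetP: fX => d _ ->; exists d; rewrite porbit_id.
have: [set (val d).1; (val d).2] \in face_edges Y
  by rewrite -eqXY; apply/imsetP; exists d.
case/imsetP=> e Ye /set2_eqP[[d1 d2]|[d1 d2]].
  have de : d = e by apply: val_inj; apply: injective_projections.
  by apply: porbits_eq fX fY Xd _; rewrite de.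
have [e' e'E] : exists e', e = f e' by exists (f^-1 e)%g; rewrite permKV.
have Ye' : e' \in Y by rewrite -(porbit_closed _ fY) -e'E.
move: d1 d2; rewrite e'E face_permE /= => d1 d2.
have: [set (val e').1; (val e').2] \in face_edges X
  by rewrite eqXY; apply/imsetP; exists e'.
case/imsetP=> g Xg /set2_eqP[[g1 g2]|[g1 g2]].
  have ge : g = e' by apply: val_inj; apply: injective_projections.
  by apply: porbits_eq fX fY Xg _; rewrite ge.
have gfd : g = f d.
  by apply: X_inj; rewrite ?porbit_closed // face_permE /= -g2.
have [] := rot_at_cycle3 (v := (val d).2) (u := (val d).1).
  by rewrite edge_sym; apply: (valP d).
by move: g1; rewrite gfd face_permE /= => <-; rewrite {1}d2 -d1 eqxx.
Qed.

Lemma num_short_faces l k : has_girth G l -> k < 2 * l ->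
  #|[set X in porbits f | #|X| == k]| <= num_cycles G k.
Proof.
move=> Gl short; rewrite -(card_in_imset (f := face_edges)).
  apply/subset_leq_card/subsetP => _ /imsetP[X + ->].
  rewrite !inE => /andP[/imsetP[d _ ->] /eqP dk].
  by rewrite -dk; apply: short_face_is_cycle Gl _; rewrite dk.
move=> X Y; rewrite !inE => /andP[fX /eqP Xk] /andP[fY _].
by apply: short_face_edges_inj Gl fX fY _; rewrite Xk.
Qed.

(** * Parity of the number of faces *)

Lemma card_dart : #|{: dart G}| = 3 * #|G|.
Proof.
rewrite card_sig -sum1_card.
rewrite -(pair_big_dep xpredT (fun u v : G => edge u v) (fun _ _ => 1)) /=.
under eq_bigr => u _.
  rewrite sum1_card.
  have -> : #|[pred v | edge u v]| = 3.
    by rewrite -[RHS](Gcubic u); apply: eq_card => v; rewrite !inE.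
  over.
by rewrite sum_nat_const mulnC.
Qed.

Definition dart_rev (d : dart G) : dart G :=
  exist (fun d : G * G => edge d.1 d.2) ((val d).2, (val d).1)
    (etrans (edge_sym _ _) (valP d)).

Lemma dart_revK : involutive dart_rev.
Proof. by move=> [[u v] e]; apply: val_inj. Qed.

Definition rev_perm : {perm dart G} := perm (inv_inj dart_revK).

(** The rotation system itself, as a permutation of darts sharing a tail. *)
Definition turn_perm : {perm dart G} := (rev_perm * f)%g.

Lemma turn_permE d :
  val (turn_perm d) = ((val d).1, rot_at rho (val d).1 (val d).2).
Proof. by rewrite permM face_permE permE. Qed.

(** The witness E is the number of edges, counted as orbits of dart reversal.  Since
    turning about the tail is even, the face permutation and the reversal have the
    same sign, and both act on the same set of darts. *)
Lemma odd_num_faces : exists E, 3 * #|G| = E * 2 /\ odd (num_faces rho) = odd E.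
Proof.
exists #|porbits rev_perm|; split.
  rewrite -card_dart; apply: fixfree_involution_porbits => d.
    by rewrite !permE dart_revK.
  rewrite permE; case: d => -[u v] euv; apply/eqP => /(congr1 val) [vu _].
  by move: euv; rewrite /= vu edge_irrefl.
have : odd_perm turn_perm = false.
  apply: odd_perm_order3 => d; apply: val_inj; rewrite !turn_permE /=.
  have [_ _ ->] := rot_at_cycle3 (valP d).
  by rewrite -surjective_pairing.
rewrite odd_permM /odd_perm -/(num_faces rho) => /eqP.
by rewrite addbACA addbb addFb => /eqP; do 2!case: odd.
Qed.

End Faces.

(** * The genus bound *)

(** With n = 2a vertices there are 3a edges, so F has the parity of a and the genus
    1 + (a - F)/2 is an integer. *)
Lemma cubic_genus_int (G : sgraph) (rho : rotation G) :
  cubic G -> cubic_genus rho \is a Num.int.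
Proof.
move=> Gcubic; have [E [GE FE]] := odd_num_faces rho Gcubic.
have [a aE] : exists a, #|G| = a.*2 by exists #|G|./2; lia.
have [b bE] : exists b : int, a%:Z = (num_faces rho)%:Z + b * 2.
  exists ((a%:Z - (num_faces rho)%:Z) %/ 2)%Z; lia.
rewrite /cubic_genus aE -muln2 natrM.
have -> : a%:R = (num_faces rho)%:R + b%:~R * 2%:R :> rat.
  by rewrite -[a%:R]/(a%:Z%:~R) bE !rmorphD rmorphM.
have -> : 1 + ((num_faces rho)%:R + b%:~R * 2%:R) * 2%:R / 4%:R
     - 1 / 2%:R * (num_faces rho)%:R = (1 + b)%:~R :> rat.
  by rewrite rmorphD /=; field.
exact: intr_int.
Qed.

(** Give a face of length k the weight w k, nonnegative exactly when k <= tau + 1.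
    The total weight is F - 3n/(tau+1), and it is at most the weight of the faces
    of length at most tau, which are counted by [num_short_faces]. *)
Lemma num_faces_le (G : sgraph) (rho : rotation G) (l tau : nat) :
    cubic G -> has_girth G l -> (tau < 2 * l)%N ->
  (num_faces rho)%:R <=
    3%:R * #|G|%:R / tau.+1%:R +
    \sum_(l <= k < tau.+1) (1 - k%:R / tau.+1%:R) * (num_cycles G k)%:R :> rat.
Proof.
move=> Gcubic Gl short; set w := fun k : nat => 1 - k%:R / tau.+1%:R : rat.
have w_ge0 k : (k < tau.+1)%N -> 0 <= w k.
  by move=> lt_k; rewrite subr_ge0 ler_pdivrMr ?ltr0Sn // mul1r ler_nat ltnW.
pose Fs := porbits (face_perm rho).
have total : \sum_(X in Fs) w #|X| =
    (num_faces rho)%:R - 3%:R * #|G|%:R / tau.+1%:R.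
  rewrite sumrB sumr_const -mulr_suml -natr_sum sum_card_porbits card_dart //.
  by rewrite natrM.
rewrite -lerBlDl -total.
have pointwise X : X \in Fs ->
    w #|X| <= \sum_(l <= k < tau.+1) (#|X| == k)%:R * w k.
  case/imsetP=> d _ ->; have := face_length_girth rho Gcubic d Gl.
  set m := #|_| => le_lm; have [lt_m|le_m] := ltnP m tau.+1.
    rewrite (big_rem m) ?mem_index_iota ?le_lm //= eqxx mul1r lerDl.
    rewrite big_seq; apply: sumr_ge0 => k /mem_rem; rewrite mem_index_iota.
    by case/andP=> _ lt_k; rewrite mulr_ge0 ?w_ge0.
  apply: (@le_trans _ _ 0).
    by rewrite subr_le0 ler_pdivlMr ?ltr0Sn // mul1r ler_nat.
  rewrite big_nat; apply: sumr_ge0 => k /andP[_ lt_k].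
  by rewrite mulr_ge0 ?w_ge0.
apply: le_trans (ler_sum _ pointwise) _; rewrite exchange_big /=.
rewrite big_nat [leRHS]big_nat; apply: ler_sum => k /andP[_ lt_k].
rewrite -mulr_suml mulrC ler_wpM2l ?w_ge0 //.
have -> : \sum_(X in Fs) (#|X| == k)%:R = #|[set X in Fs | #|X| == k]|%:R :> rat.
  rewrite -natr_sum -sum1_card; congr _%:R.
  rewrite big_mkcond [RHS]big_mkcond /=; apply: eq_bigr => X _.
  by rewrite inE; case: (X \in Fs); case: (_ == k).
by rewrite ler_nat; apply: num_short_faces Gl _ => //; lia.
Qed.

Theorem proposition13p1 (G : sgraph) (n l : nat)
    (Gconn : connected G) (Gcubic : cubic G) (Gn : #|G| = n)
    (Gl : has_girth G l) :
  cubic_min_genus G \is a Num.int /\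
  forall tau : nat, (l.-1 <= tau <= (2 * l).-1)%N ->
    let bound : rat :=
      1 + n%:R / 4%:R - 1 / 2%:R *
        (3%:R * n%:R / tau.+1%:R +
         \sum_(l <= k < tau.+1)
            (1 - k%:R / tau.+1%:R) * (num_cycles G k)%:R) in
    bound <= cubic_min_genus G /\
    (Num.ceil bound)%:~R <= cubic_min_genus G.
Proof.
have l_gt0 : (0 < l)%N.
  by have [[C /andP[l_gt2 _]] _] := Gl; apply: leq_trans l_gt2.
have [rho genusE] : exists rho : rotation G, cubic_min_genus G = cubic_genus rho
  by eexists; reflexivity.
have g_int := cubic_genus_int rho Gcubic.
rewrite {}genusE; split=> // tau /andP[_ le_tau].
intro bound.
have bound_le : bound <= cubic_genus rho.
  have short : (tau < 2 * l)%N by lia.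
  have := num_faces_le rho Gcubic Gl short.
  by rewrite /bound /cubic_genus -Gn lerD2l lerN2; apply: ler_wpM2l.
split=> //; case/intrP: g_int bound_le => z -> bound_le.
by rewrite ler_int ceil_le_int.
Qed.
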